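(* For every $L$ there exist positive constants $c_1,c_2,c_3$ depending only on $L$ for which the following holds. Let $X$ be an isotropic random vector in $\mathbb{R}^n$ and assume that $\|\langle X,t\rangle\|_{L_2}\le L\,\|\langle X,t\rangle\|_{L_1}$ for every $t\in S^{n-1}$. Let $X_1,\dots,X_N$ be independent copies of $X$ and let $\Gamma=\frac{1}{\sqrt N}\sum_{i=1}^N\langle X_i,\cdot\rangle e_i$. If $N\ge c_1n$, then with probability at least $1-2\exp(-c_2N)$, $$\lambda_{\min}(\Gamma)\ge c_3.$$
   Context: $S^{n-1}$ is the Euclidean unit sphere of $\mathbb{R}^n$ and $\langle\cdot,\cdot\rangle$ the standard inner product. A random vector $X$ in $\mathbb{R}^n$ is isotropic if $\mathbb{E}\langle X,t\rangle^2=\|t\|_{\ell_2^n}^2$ for every $t\in\mathbb{R}^n$ (no mean-zero assumption). For a real random variable $Y$, $\|Y\|_{L_p}=(\mathbb{E}|Y|^p)^{1/p}$. $(e_i)_{i=1}^N$ is the canonical basis of $\mathbb{R}^N$, so $\Gamma$ is the $N\times n$ random matrix with rows $X_1/\sqrt N,\dots,X_N/\sqrt N$, and $\lambda_{\min}(\Gamma)=\inf_{t\in S^{n-1}}\|\Gamma t\|_{\ell_2^N}$ is its smallest singular value. *)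

(* Defs.v *)
From HB Require Import structures.
From mathcomp Require Import all_boot all_order all_algebra.
From mathcomp Require Import all_classical all_reals all_analysis.

Set Implicit Arguments.
Unset Strict Implicit.
Unset Printing Implicit Defensive.
Import Order.TTheory GRing.Theory Num.Theory.

Local Open Scope classical_set_scope.
Local Open Scope ring_scope.

Definition inner (R : realType) (n : nat) (x y : 'cV[R]_n) : R :=
  \sum_(j < n) x j 0 * y j 0.

Definition l2norm (R : realType) (n : nat) (x : 'cV[R]_n) : R :=
  Num.sqrt (inner x x).

(* S^{n-1}, inside 'cV[R]_n *)
Definition sphere (R : realType) (n : nat) : set 'cV[R]_n :=
  [set t | l2norm t = 1].
Arguments sphere : clear implicits.

(* Random vectors take values in n.-tuple R, which carries the product of the
   Borel sigma-algebras; vec reads such a tuple as a vector of R^n. *)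
Definition vec (R : realType) (n : nat) (x : n.-tuple R) : 'cV[R]_n :=
  \col_(j < n) tnth x j.

Definition isotropic d (T : measurableType d) (R : realType)
    (P : probability T R) (n : nat) (X : {RV P >-> n.-tuple R}) : Prop :=
  forall t : 'cV[R]_n,
    ('E_P[(fun w => inner (vec (X w)) t ^+ 2)%R] = (l2norm t ^+ 2)%:E)%E.

(* Only measurable sets are compared: the value of a measure elsewhere is
   arbitrary. *)
Definition same_distribution d1 d2 d' (T1 : measurableType d1)
    (T2 : measurableType d2) (U : measurableType d') (R : realType)
    (P1 : probability T1 R) (P2 : probability T2 R)
    (X1 : {RV P1 >-> U}) (X2 : {RV P2 >-> U}) : Prop :=
  forall B : set U, measurable B -> distribution P1 X1 B = distribution P2 X2 B.

Definition independent d d' (T : measurableType d) (U : measurableType d')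
    (R : realType) (P : probability T R) (I : finType)
    (X : I -> {RV P >-> U}) : Prop :=
  forall (J : {set I}) (B : I -> set U), (forall i, measurable (B i)) ->
    P (\bigcap_(i in [set` J]) (X i @^-1` B i)) =
    (\prod_(i in J) P (X i @^-1` B i))%E.

(* The N x n matrix with rows x_1 / sqrt N, ..., x_N / sqrt N, i.e. the matrix
   of N^{-1/2} \sum_i <x_i, .> e_i. *)
Definition Gamma (R : realType) (N n : nat) (x : 'I_N -> 'cV[R]_n) :
    'M[R]_(N, n) :=
  (Num.sqrt N%:R)^-1 *: \matrix_(i < N) (x i)^T.

(* Meaningful for n > 0 only: sphere R 0 is empty and inf set0 = 0. *)
Definition lambda_min (R : realType) (N n : nat) (A : 'M[R]_(N, n)) : R :=
  inf [set l2norm (A *m t) | t in sphere R n].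

(* Main.v *)
Require Import Defs.
From HB Require Import structures.
From mathcomp Require Import all_boot all_order all_algebra.
From mathcomp Require Import all_classical all_reals all_analysis.
From mathcomp Require Import measurable_realfun.
From mathcomp Require Import ring lra zify.

Set Implicit Arguments.
Unset Strict Implicit.
Unset Printing Implicit Defensive.
Import Order.TTheory GRing.Theory Num.Theory.

Local Open Scope classical_set_scope.
Local Open Scope ring_scope.

(** The proof combines a small-ball estimate with a net of size exponential in
the dimension; the passage from the net to the sphere rests on rounding to a
lattice rather than on a bound for the operator norm of [Gamma].

Small ball. For a unit vector t, E<X,t>^2 = 1 and E|<X,t>| >= 1/L. Since
E|X|^2 = n, the event that |<X,t>| >= 1/(4L) and |X|^2 <= 4 L^2 n at the same
time has probability at least q = 1/(4L^2) ([isotropic_spread]). Independence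
then makes this happen for at least (q^2/8) N of the X_i, outside a set of
probability at most exp(-qN/4) ([few_successes]). The long rows, which may be
arbitrarily long for want of a tail estimate, are simply discarded.

Net. Scale the integer lattice to mesh h = 1/(r sqrt n). Every unit vector t is
within distance 1/r of a mesh point, and the mesh points involved all lie in a
ball of radius 2, so there are at most exp(C_r n) of them, by counting integer
vectors ([int_ball_card]). When N is at least c_1 n, a union bound over this
family costs at most half of the exponent qN/4.

From the net to the sphere. The supremum of |<X_i,t-y>| over t near y is out of
control, but it is not what matters. Moving t to the lattice one coordinate at a
time, up or down whichever makes the linear term nonpositive, increases a
nonnegative quadratic form by at most h^2 times its trace ([greedy_rounding]).
For the form y |-> (1/N) sum <X_i,y>^2 taken over the rows with
|X_i|^2 <= 4 L^2 n, the trace is at most 4 L^2 n, so the loss is at most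
4 L^2 / r^2 whatever n is. Hence the lower bound on the net, of order q^3, passes
to t once r is large depending on L only ([truncated_gram_ge]).

The same rounding shows that a lower bound for the form on integer vectors
implies it on all vectors; this gives the measurability of the event in the
theorem ([measurable_lambda_min_Gamma]). *)

(** * Quadratic forms and rounding to a lattice *)

(** Being quadratic along each coordinate direction is the only property that
rounding one coordinate at a time uses; [d] is the diagonal of the form. *)
Definition quadratic (R : realType) (n : nat) (q : 'cV[R]_n -> R)
    (d : 'I_n -> R) :=
  exists b : 'I_n -> 'cV[R]_n -> R, forall j x a,
    q (x + a *: delta_mx j 0) = q x + a * b j x + a ^+ 2 * d j.

(** Between the two lattice neighbours of a coordinate, one lies in the direction
in which the linear term of the form does not increase; moving there costs only
the second-order term, at most [h ^+ 2 * `|d j|]. *)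
Lemma greedy_rounding (R : realType) (n : nat) (q : 'cV[R]_n -> R)
    (d : 'I_n -> R) (h : R) (t : 'cV[R]_n) :
  0 < h -> quadratic q d ->
  exists z : 'cV[int]_n, (forall j, `|h * (z j 0)%:~R - t j 0| <= h) /\
    q (\col_j (h * (z j 0)%:~R)) <= q t + h ^+ 2 * \sum_j `|d j|.
Proof.
move=> h0 [b qE].
(* Only the coordinates listed so far are rounded; the others still agree with
   [t]. *)
suff [y [z [yz yt]]] : exists y : 'cV[R]_n, exists z : 'cV[int]_n,
    [/\ (forall j, j \in enum 'I_n -> y j 0 = h * (z j 0)%:~R),
        (forall j, `|y j 0 - t j 0| <= h),
        (forall j, j \notin enum 'I_n -> y j 0 = t j 0) &
        q y <= q t + h ^+ 2 * \sum_(j <- enum 'I_n) `|d j|].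
  move=> _ qy; exists z; split.
    by move=> j; rewrite -yz ?mem_enum.
  suff -> : \col_j (h * (z j 0)%:~R) = y by rewrite big_enum in qy.
  by apply/colP => j; rewrite mxE yz ?mem_enum.
elim: (enum 'I_n) (enum_uniq 'I_n) => [_|i s IH /= /andP[is_ us]].
  exists t, 0; split => //; first by move=> j; rewrite subrr normr0 ltW.
  by rewrite big_nil mulr0 addr0.
have [y [z [yz yt yt' qy]]] := IH us.
pose m := Num.floor (y i 0 / h).
have m1 : h * m%:~R <= y i 0 by rewrite mulrC -ler_pdivlMr// floor_le_tmp.
have m2 : y i 0 < h * (m + 1)%:~R by rewrite mulrC -ltr_pdivrMr// floorD1_gt.
(* [h * k] is the neighbour of [y i 0] on the side opposite to the sign of
   [b i y]. *)
have [k [k1 k2]] : exists k : int, `|h * k%:~R - y i 0| <= h /\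
   (h * k%:~R - y i 0) * b i y <= 0.
  have m3 : h * (m + 1)%:~R = h * m%:~R + h by rewrite intrD mulrDr mulr1.
  have [b0|b0] := leP 0 (b i y).
    exists m; split; first by rewrite ler_norml; apply/andP; split; lra.
    by apply: mulr_le0_ge0 => //; lra.
  exists (m + 1); split; first by rewrite ler_norml; apply/andP; split; lra.
  by apply: mulr_ge0_le0; [lra|exact: ltW].
set a := _ - _ in k1 k2.
exists (y + a *: delta_mx i 0), (\col_j (if j == i then k else z j 0)).
have yi : y i 0 = t i 0 by apply: yt'.
have yE j : (y + a *: delta_mx i 0) j 0 = if j == i then h * k%:~R else y j 0.
  rewrite !mxE eqxx andbT; case: eqP => [->|_]; last by rewrite mulr0 addr0.
  by rewrite mulr1 /a addrC subrK.
split.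
- move=> j; rewrite inE yE mxE; case: eqP => //= _; exact: yz.
- move=> j; rewrite yE; case: eqP => [->|_] //; by rewrite -yi.
- by move=> j; rewrite inE negb_or yE => /andP[/negbTE -> /yt'].
rewrite qE big_cons mulrDr.
have ad : a ^+ 2 * d i <= h ^+ 2 * `|d i|.
  apply: (@le_trans _ _ (a ^+ 2 * `|d i|)); first exact/ler_wpM2l/ler_norm/sqr_ge0.
  by rewrite ler_wpM2r// -(real_normK (num_real a)) lerXn2r// nnegrE ltW.
lra.
Qed.

(** An integer vector is a sign pattern ([2 ^ n] choices) and a vector of absolute
values. The entries of the latter sum to at most the sum of their squares, hence
at most [m], and there are ['C(n + m, n) <= 2 ^ (n + m)] such vectors. *)
Lemma int_ball_card (n m : nat) :
  exists s : seq 'cV[int]_n, (size s <= 2 ^ (n + n + m))%N /\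
    forall z : 'cV[int]_n, (\sum_j `|z j 0%R| ^ 2 <= m)%N -> z \in s.
Proof.
pose f (p : n.-tuple 'I_m.+1 * {ffun 'I_n -> bool}) : 'cV[int]_n :=
  \col_j ((-1) ^+ p.2 j * (tnth p.1 j)%:Z).
pose D := finset.setX
   [set t : n.-tuple 'I_m.+1 | (\sum_(i <- t) i <= m)%N]%SET
   [set: {ffun 'I_n -> bool}]%SET.
exists [seq f p | p in D]; split.
  rewrite size_image cardsX card_partial_ord_partitions cardsT card_ffun.
  rewrite card_bool.
  rewrite card_ord addnAC expnD leq_mul2r; apply/orP; right.
  have := max_card (fun A : {set 'I_(n + m)} => #|A| == n).
  have -> : #|{set 'I_(n + m)}| = (2 ^ (n + m))%N.
    by rewrite -cardsT -powersetT card_powerset cardsT card_ord.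
  by rewrite -cardsE card_draws card_ord.
move=> z zm; apply/fintype.imageP.
have zm' j : (`|z j 0%R| < m.+1)%N.
  rewrite ltnS; apply: leq_trans zm; rewrite (bigD1 j)//=.
  apply: leq_trans (leq_addr _ _); case: `|z j 0%R|%N => // k.
  by rewrite expnS leq_pmulr ?expn_gt0.
pose t : n.-tuple 'I_m.+1 := [tuple Ordinal (zm' j) | j < n].
exists (t, [ffun j => (z j 0 < 0)%R]).
  rewrite !inE andbT /=; apply: leq_trans zm.
  rewrite (big_tuple _ _ t); apply: leq_sum => j _; rewrite tnth_mktuple /=.
  by case: `|z j 0%R|%N => // k; rewrite expnS leq_pmulr ?expn_gt0.
apply/colP => j; rewrite mxE /= tnth_mktuple ffunE /=.
by rewrite [LHS]intEsign.
Qed.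

Section sqnorm.
Variables (R : realType) (n : nat).
Implicit Types x y t : 'cV[R]_n.

Lemma sqnormE x : inner x x = \sum_j x j 0 ^+ 2.
Proof. by apply: eq_bigr => j _; rewrite expr2. Qed.

Lemma inner_ge0 x : 0 <= inner x x.
Proof. by rewrite sqnormE sumr_ge0// => j _; exact: sqr_ge0. Qed.

Lemma sqr_l2norm x : l2norm x ^+ 2 = inner x x.
Proof. by rewrite /l2norm sqr_sqrtr// inner_ge0. Qed.

Lemma sphereE t : sphere R n t <-> inner t t = 1.
Proof.
rewrite -sqr_l2norm /sphere /=; split => [->|]; first by rewrite expr1n.
move/eqP; rewrite sqrp_eq1 ?sqrtr_ge0// => /eqP; exact.
Qed.

Lemma innerDZ_delta x y (a : R) j :
  inner x (y + a *: delta_mx j 0) = inner x y + a * x j 0.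
Proof.
rewrite /inner; under eq_bigr do rewrite !mxE mulrDr.
rewrite big_split/=; congr (_ + _).
rewrite (bigD1 j)//= !eqxx mulr1 big1 ?addr0 1?mulrC// => i /negbTE ij.
by rewrite ij !mulr0.
Qed.

Lemma innerZr x y (a : R) : inner x (a *: y) = a * inner x y.
Proof.
by rewrite /inner big_distrr; apply: eq_bigr => j _; rewrite mxE mulrCA.
Qed.

Lemma sqnormZ x (a : R) : inner (a *: x) (a *: x) = a ^+ 2 * inner x x.
Proof.
rewrite !sqnormE big_distrr; apply: eq_bigr => j _; rewrite mxE /=; ring.
Qed.

Lemma sqnorm_le2 x y :
  inner x x <= 2 * inner y y + 2 * \sum_j (y j 0 - x j 0) ^+ 2.
Proof.
rewrite !sqnormE !big_distrr -big_split; apply: ler_sum => j _ /=.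
have := sqr_ge0 (y j 0 + (y j 0 - x j 0)); nra.
Qed.

End sqnorm.

Section quadratic_forms.
Variables (R : realType) (n : nat).

Lemma quadratic_sum (I : finType) (a : I -> R) (x : I -> 'cV[R]_n) :
  quadratic (fun y => \sum_i a i * inner (x i) y ^+ 2)
            (fun j => \sum_i a i * x i j 0 ^+ 2).
Proof.
exists (fun j y => \sum_i a i * (2 * x i j 0 * inner (x i) y)) => j y e.
rewrite !big_distrr -!big_split; apply: eq_bigr => i _ /=.
rewrite innerDZ_delta; ring.
Qed.

Lemma quadratic_sub_sqnorm (q : 'cV[R]_n -> R) d (c : R) : quadratic q d ->
  quadratic (fun y => q y - c * inner y y) (fun j => d j - c).
Proof.
move=> [b qE]; exists (fun j y => b j y - 2 * c * y j 0) => j y e.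
rewrite qE innerDZ_delta.
have -> : inner (y + e *: delta_mx j 0) y = inner y y + e * y j 0.
  by rewrite -innerDZ_delta /inner; apply: eq_bigr => k _; rewrite mulrC.
by rewrite !mxE eqxx /=; ring.
Qed.

(** If [q y < 0], rounding [y] to a lattice of small enough mesh keeps the value
negative, and by homogeneity the mesh scales away. *)
Lemma quadratic_ge0_int (q : 'cV[R]_n -> R) d : quadratic q d ->
  (forall a y, q (a *: y) = a ^+ 2 * q y) ->
  (forall z : 'cV[int]_n, 0 <= q (map_mx intr z)) -> forall y, 0 <= q y.
Proof.
move=> qd qZ q0 y; rewrite leNgt; apply/negP => qy.
have D0 : 0 <= \sum_j `|d j| by rewrite sumr_ge0.
set D := \sum_j `|d j| in D0.
(* The square of a mesh for which the rounding error is less than [- q y]. *)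
have e0 : 0 < - q y / (D + 1) by rewrite divr_gt0; lra.
pose h := Num.sqrt (- q y / (D + 1)).
have hE : h ^+ 2 = - q y / (D + 1) by rewrite sqr_sqrtr// ltW.
have h0 : 0 < h by rewrite sqrtr_gt0.
have [z [_ qz]] := greedy_rounding y h0 qd.
have : 0 <= q (\col_j (h * (z j 0)%:~R)).
  rewrite (_ : \col_j _ = h *: map_mx intr z); last by apply/colP => j; rewrite !mxE.
  by rewrite qZ mulr_ge0// sqr_ge0.
apply/negP; rewrite -ltNge; apply: le_lt_trans qz _.
have : h ^+ 2 * (D + 1) = - q y by rewrite hE divfK// gt_eqF; lra.
have : 0 < h ^+ 2 by rewrite hE.
rewrite -/D; lra.
Qed.

End quadratic_forms.

(** A net for the sphere adapted to quadratic forms: its size is exponential in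
[n] for fixed [r], while the loss on a form of trace [K * n] is [K / r ^+ 2],
independent of [n]. *)
Lemma rounding_net (R : realType) (n r : nat) : (0 < n)%N -> (2 <= r)%N ->
  exists s : seq 'cV[R]_n, [/\ (size s <= 2 ^ ((4 * r ^ 2 + 2) * n))%N,
    (forall y, y \in s -> 1 / 4 <= inner y y) &
    forall q d t, quadratic q d -> sphere R n t -> exists2 y, y \in s &
      q y <= q t + (r%:R ^+ 2 * n%:R)^-1 * \sum_j `|d j|].
Proof.
move=> n0 r2.
have N0 : 0 < n%:R :> R by rewrite ltr0n.
have r2' : 2 <= r%:R :> R by rewrite ler_nat.
have R0 : 0 < r%:R :> R by lra.
have M0 : 0 < r%:R ^+ 2 * n%:R :> R by rewrite mulr_gt0// exprn_gt0.
(* With this mesh a rounded vector moves by at most [1 / r <= 1 / 2]. *)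
pose h : R := Num.sqrt (r%:R ^+ 2 * n%:R)^-1.
have hE : h ^+ 2 = (r%:R ^+ 2 * n%:R)^-1 by rewrite sqr_sqrtr// invr_ge0 ltW.
have h0 : 0 < h by rewrite sqrtr_gt0 invr_gt0.
have hn : h ^+ 2 * n%:R <= 1 / 4.
  rewrite hE invfM -mulrA mulVf ?gt_eqF// mulr1 div1r lef_pV2 ?posrE; nra.
have [s [sz sP]] := int_ball_card n (4 * r ^ 2 * n).
pose g (z : 'cV[int]_n) : 'cV[R]_n := \col_j (h * (z j 0)%:~R).
exists [seq y <- [seq g z | z <- s] | 1 / 4 <= inner y y]; split.
- rewrite size_filter; apply: leq_trans (count_size _ _) _.
  by rewrite size_map (leq_trans sz)// leq_exp2l//; lia.
- by move=> y; rewrite mem_filter => /andP[].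
move=> q d t qd /sphereE t1.
have [z [zt qz]] := greedy_rounding t h0 qd.
exists (g z); last by rewrite -hE.
have zt2 : \sum_j (g z j 0 - t j 0) ^+ 2 <= 1 / 4.
  apply: le_trans hn; rewrite mulr_natr -[X in h ^+ 2 *+ X]card_ord -sumr_const.
  apply: ler_sum => j _; rewrite mxE -(real_normK (num_real (_ - _))) lerXn2r// nnegrE//.
  exact: ltW.
rewrite mem_filter; apply/andP; split.
  have := sqnorm_le2 t (g z); lra.
apply/map_f/sP; rewrite -(ler_nat R) natr_sum.
have : inner (g z) (g z) <= 4.
  have := sqnorm_le2 (g z) t; under eq_bigr do rewrite -sqrrN opprB.
  lra.
rewrite sqnormE => gz.
have -> : \sum_j (`|z j 0%R| ^ 2)%N%:R = (h ^+ 2)^-1 * \sum_j g z j 0 ^+ 2.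
  rewrite big_distrr; apply: eq_bigr => j _ /=.
  rewrite mxE exprMn mulKf ?sqrf_eq0 ?gt_eqF//.
  by rewrite natrX natr_absz intr_norm real_normK ?num_real.
rewrite hE invrK !natrM.
nra.
Qed.

(** * The smallest singular value *)

Section smallest_singular_value.
Variables (R : realType) (n N : nat).
Implicit Types x : 'I_N -> 'cV[R]_n.

Lemma sqnorm_Gamma x (t : 'cV[R]_n) :
  inner (Gamma x *m t) (Gamma x *m t) = \sum_i N%:R^-1 * inner (x i) t ^+ 2.
Proof.
rewrite sqnormE; apply: eq_bigr => i _.
rewrite /Gamma -scalemxAl mxE exprMn exprVn sqr_sqrtr ?ler0n//; congr (_ * _ ^+ 2).
by rewrite mxE /inner; apply: eq_bigr => j _; rewrite !mxE.
Qed.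

Lemma lambda_min_geP (A : 'M[R]_(N, n)) (c : R) : (0 < n)%N -> 0 <= c ->
  c <= lambda_min A <->
  forall t, sphere R n t -> c ^+ 2 <= inner (A *m t) (A *m t).
Proof.
move=> n0 c0.
have sqE t : (c ^+ 2 <= inner (A *m t) (A *m t)) = (c <= l2norm (A *m t)).
  by rewrite -sqr_l2norm ler_sqr// nnegrE sqrtr_ge0.
split => [cA t t1|H].
  rewrite sqE (le_trans cA)//; apply: ge_inf; last by exists t.
  by exists 0 => _ [s _ <-]; rewrite sqrtr_ge0.
apply: lb_le_inf; last by move=> _ [s s1 <-]; rewrite -sqE; exact: H.
pose t : 'cV[R]_n := delta_mx (Ordinal n0) 0.
exists (l2norm (A *m t)), t => //; apply/sphereE.
rewrite sqnormE (bigD1 (Ordinal n0))//= mxE !eqxx expr1n big1 ?addr0// => i.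
by move=> /negbTE ij; rewrite mxE ij expr0n.
Qed.

(** Countably many test vectors suffice, which is what makes the event on the left
measurable when [x] is random. *)
Lemma lambda_min_Gamma_intP x (c : R) : (0 < n)%N -> 0 <= c ->
  c <= lambda_min (Gamma x) <->
  forall z : 'cV[int]_n,
    c ^+ 2 * inner (map_mx intr z) (map_mx intr z) <=
    \sum_i N%:R^-1 * inner (x i) (map_mx intr z) ^+ 2.
Proof.
move=> n0 c0; rewrite lambda_min_geP//; split => [H z|H t /sphereE t1].
  set y := map_mx intr z.
  have [y0|y0] := eqVneq (inner y y) 0.
    by rewrite y0 mulr0 sumr_ge0// => i _; rewrite mulr_ge0 ?sqr_ge0// invr_ge0.
  have l0 : 0 < inner y y by rewrite lt_def y0 inner_ge0.
  pose a := (Num.sqrt (inner y y))^-1.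
  have aE : a ^+ 2 = (inner y y)^-1 by rewrite exprVn sqr_sqrtr// ltW.
  have /H : sphere R n (a *: y) by apply/sphereE; rewrite sqnormZ aE mulVf.
  rewrite -scalemxAr sqnormZ aE sqnorm_Gamma mulrC.
  by rewrite ler_pdivlMr.
rewrite sqnorm_Gamma -subr_ge0.
have -> : c ^+ 2 = c ^+ 2 * inner t t by rewrite t1 mulr1.
apply: (@quadratic_ge0_int _ _ _ _ (quadratic_sub_sqnorm (c ^+ 2)
  (quadratic_sum (fun=> N%:R^-1) x))).
  move=> a y /=; rewrite sqnormZ mulrBr [in RHS]big_distrr; congr (_ - _); last exact: mulrCA.
  by apply: eq_bigr => i _ /=; rewrite innerZr exprMn mulrCA.
by move=> z; rewrite subr_ge0; exact: H.
Qed.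

End smallest_singular_value.

Section measurability.
Variables (R : realType) (n : nat).

Lemma measurable_inner_vec (t : 'cV[R]_n) :
  measurable_fun setT (fun x : n.-tuple R => inner (vec x) t).
Proof.
apply: measurable_sum => j; apply: measurable_funM => //.
by under eq_fun do rewrite mxE; exact: measurable_tnth.
Qed.

Lemma measurable_sqnorm_vec :
  measurable_fun setT (fun x : n.-tuple R => inner (vec x) (vec x)).
Proof.
apply: measurable_sum => j.
by under eq_fun do rewrite mxE; apply: measurable_funM; exact: measurable_tnth.
Qed.

Lemma measurable_lambda_min_Gamma d (T : measurableType d)
    (P : probability T R) (N : nat) (Xs : 'I_N -> {RV P >-> n.-tuple R})
    (c : R) : (0 < n)%N -> 0 <= c ->
  measurable [set w | c <= lambda_min (Gamma (fun i => vec (Xs i w)))].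
Proof.
move=> n0 c0.
pose F (z : 'cV[int]_n) := let y : 'cV[R]_n := map_mx intr z in
  [set w | c ^+ 2 * inner y y <= \sum_i N%:R^-1 * inner (vec (Xs i w)) y ^+ 2].
rewrite (_ : [set w | _] = ~` \bigcup_z ~` F z); last first.
  rewrite setC_bigcup; under eq_bigcapr do rewrite setCK.
  apply/seteqP; split => w /=.
    by move=> /(lambda_min_Gamma_intP _ n0 c0) H z _; exact: H.
  by move=> H; apply/(lambda_min_Gamma_intP _ n0 c0) => z; exact: (H z).
apply: measurableC; apply: countable_bigcupT_measurable; first exact: countableP.
move=> z; apply: measurableC; rewrite -[F z]setTI.
apply: measurable_fun_le => //; apply: measurable_sum => i.
apply: measurable_funM => //; apply: measurable_funX.
by apply: measurableT_comp (measurable_inner_vec _) _.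
Qed.

(** The vectors that are useful in direction [y]: a large marginal, and a norm that
is not too large, so that rounding [y] does not spoil the marginal. *)
Definition spread_set (a k : R) (y : 'cV[R]_n) : set (n.-tuple R) :=
  [set x | a <= `|inner (vec x) y| /\ inner (vec x) (vec x) <= k].

Lemma measurable_spread_set a k y : measurable (spread_set a k y).
Proof.
rewrite (_ : spread_set a k y = [set x | a <= `|inner (vec x) y|] `&`
  [set x | inner (vec x) (vec x) <= k])//.
rewrite -[X in measurable (X `&` _)]setTI -[X in measurable (_ `&` X)]setTI.
apply: measurableI; apply: measurable_fun_le => //.
- by apply: measurableT_comp (measurable_inner_vec _).
- exact: measurable_sqnorm_vec.
Qed.

End measurability.

(** * Independent trials *)

Lemma union_bound d (T : measurableType d) (R : realType)
    (P : probability T R) (I : eqType) (s : seq I) (p : pred I)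
    (F : I -> set T) (e : I -> R) :
  (forall i, i \in s -> p i -> measurable (F i)) ->
  (forall i, i \in s -> p i -> (P (F i) <= (e i)%:E)%E) ->
  exists B : set T, [/\ measurable B, (P B <= (\sum_(i <- s | p i) e i)%:E)%E &
    forall i, i \in s -> p i -> F i `<=` B].
Proof.
elim: s => [|i s IH] mF eF.
  by exists set0; split => //; rewrite big_nil measure0.
have [||B [mB PB FB]] := IH.
- by move=> j js; apply: mF; rewrite inE js orbT.
- by move=> j js; apply: eF; rewrite inE js orbT.
case pi : (p i); last first.
  exists B; split => //; first by rewrite big_cons pi.
  by move=> j /[!inE] /orP[/eqP -> | js]; [rewrite pi|exact: FB].
have iis : i \in i :: s by rewrite inE eqxx.
exists (F i `|` B); split.
- by apply: measurableU => //; exact: mF.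
- rewrite big_cons pi EFinD (le_trans (measureU2 _ _ _))//; first exact: mF.
  by apply: leeD => //; exact: eF.
- move=> j /[!inE] /orP[/eqP -> _|js pj]; first exact: subsetUl.
  by apply: (subset_trans (FB _ js pj)); exact: subsetUr.
Qed.

(** A Chernoff bound from product probabilities of intersections alone. If there
are too few successes, then all the trials outside a small set [J] fail, which
has probability at most [(1 - q) ^ (N - #|J|)]. Weighting [J] by
[s ^ (#|J| - delta * N) >= 1], with [s = q / 2], turns the union bound over [J]
into a binomial sum, [s ^ (- delta * N) * (s + 1 - q) ^ N]. The exceptional set
is returned as a measurable set containing the event. *)
Lemma few_successes d (T : measurableType d) d' (U : measurableType d')
    (R : realType) (P : probability T R) (N : nat) (Xs : 'I_N -> {RV P >-> U})
    (A : set U) (q : R) :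
  independent Xs -> measurable A -> 0 < q -> q <= 1 ->
  (forall i, q%:E <= P (Xs i @^-1` A))%E ->
  exists B : set T, [/\ measurable B, (P B <= (expR (- (q / 4 * N%:R)))%:E)%E &
    forall w, ~ B w ->
      q ^+ 2 / 8 * N%:R <= #|[set i | `[< A (Xs i w) >]]%SET|%:R].
Proof.
move=> ind mA q0 q1 qA.
pose delta := q ^+ 2 / 8; pose s := q / 2.
have s0 : 0 < s by rewrite /s; lra.
have s1 : s <= 1 by rewrite /s; lra.
pose F (J : {set 'I_N}) : set T :=
  \bigcap_(i in [set` (~: J)%SET]) (Xs i @^-1` ~` A).
pose p (J : {set 'I_N}) := (#|J|%:R < delta * N%:R).
have mA' i : measurable (Xs i @^-1` A).
  exact: measurable_funPTI.
have mAC i : measurable (Xs i @^-1` ~` A).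
  by apply: measurable_funPTI; exact: measurableC.
have mF J : measurable (F J).
  by apply: fin_bigcap_measurable => // i _.
have PF J : (P (F J) <= ((1 - q) ^+ #|(~: J)%SET|)%:E)%E.
  rewrite /F (ind _ (fun=> ~` A)); last by move=> i; exact: measurableC.
  rewrite (eq_bigr (fun i => (fine (P (Xs i @^-1` ~` A)))%:E)); last first.
    by move=> i _; rewrite fineK// fin_num_measure.
  rewrite prodEFin lee_fin -prodr_const; apply: ler_prod => i _.
  rewrite fine_ge0//= -lee_fin fineK ?fin_num_measure//.
  have -> : P (Xs i @^-1` ~` A) = (1 - P (Xs i @^-1` A))%E.
    exact: (probability_setC P (mA' i)).
  exact: (leeB (lexx 1%E) (qA i)).
have [||B [mB PB FB]] := @union_bound _ _ _ P _ (index_enum _) p F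
   (fun J => (1 - q) ^+ #|(~: J)%SET|).
- by move=> J _ _; exact: mF.
- by move=> J _ _; exact: PF.
exists B; split => //; last first.
  move=> w nB; rewrite leNgt; apply/negP => pJ; apply: nB.
  apply: (FB _ (mem_index_enum _) pJ) => i /=.
  by rewrite !inE => /asboolPn.
apply: (le_trans PB); rewrite lee_fin.
have lns : - ln s <= 2 / q.
  rewrite -lnV ?posrE// /s invf_div; apply: le_trans (ltW (ln_sublinear _)) _ => //.
  by rewrite divr_gt0.
apply: (@le_trans _ _ (\sum_(J in {set 'I_N})
    expR (- ln s * (delta * N%:R)) * (s ^+ #|J| * (1 - q) ^+ #|(~: J)%SET|))).
  rewrite big_mkcond /=; apply: ler_sum => J _; rewrite /p.
  have q1' : 0 <= (1 - q) ^+ #|(~: J)%SET| by rewrite exprn_ge0// subr_ge0.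
  case: ifP => [Jl|_]; last first.
    by rewrite mulr_ge0 ?expR_ge0// mulr_ge0// exprn_ge0// ltW.
  rewrite mulrA ler_peMl//.
  rewrite -[X in X ^+ _](lnK s0) -expRM_natl -expRD -[leLHS]expR0 ler_expR.
  have := ln_le0 s1; nra.
rewrite -big_distrr /=.
have -> : \sum_(J in {set 'I_N}) s ^+ #|J| * (1 - q) ^+ #|(~: J)%SET| =
    (s + (1 - q)) ^+ N.
  rewrite -[in RHS](card_ord N) -prodr_const bigA_distr; apply: eq_bigr => J _.
  rewrite (bigID (mem J)) /= -!prodr_const; congr (_ * _).
    by apply: eq_bigr => i ->.
  by apply: eq_big => i; rewrite inE //; move/negbTE => ->.
have : (s + (1 - q)) ^+ N <= expR (- s * N%:R).
  rewrite mulr_natr -mulr_natl expRM_natl lerXn2r// ?nnegrE ?expR_ge0//.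
    by rewrite /s; lra.
  by apply: le_trans (expR_ge1Dx _); rewrite /s; lra.
move=> H; apply: le_trans (ler_wpM2l (expR_ge0 _) H) _.
rewrite -expRD ler_expR mulrA -mulrDl mulNr -[leRHS]mulNr; apply: ler_wpM2r => //.
have : - ln s * delta <= q / 4.
  apply: le_trans (ler_wpM2r _ lns) _; first by rewrite /delta; nra.
  rewrite /delta le_eqVlt; apply/orP; left; apply/eqP; field; lra.
rewrite /s; lra.
Qed.

(** * Small-ball estimates *)

(** A Paley-Zygmund inequality with the extra constraint that [Z] is bounded by a
multiple of its mean. It follows by integrating the pointwise inequality
[`|Y| <= a + a * Y ^+ 2 + L * (\1_B + Z / (4 * L ^+ 2 * k))], where
[a = (4 * L)^-1]. Off [B], either [`|Y| < a] or the last quotient is at least 1;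
in the latter case, and on [B], it reduces to [`|Y| <= a * Y ^+ 2 + L], which is
the AM-GM inequality. *)
Lemma truncated_small_ball d (T : measurableType d) (R : realType)
    (P : probability T R) (Y Z : T -> R) (L k : R) :
  measurable_fun setT Y -> measurable_fun setT Z -> (forall w, 0 <= Z w) ->
  0 < L -> 0 < k ->
  (\int[P]_w (Y w ^+ 2)%:E = 1)%E -> (\int[P]_w (Z w)%:E = k%:E)%E ->
  (1 <= L%:E * \int[P]_w `|Y w|%:E)%E ->
  (((4 * L ^+ 2)^-1)%:E <=
    P [set w | (4 * L)^-1 <= `|Y w| /\ Z w <= 4 * L ^+ 2 * k]%R)%E.
Proof.
move=> mY mZ Z0 L0 k0 Y2 Zk YL.
set B := [set w | _].
have mnY : measurable_fun setT (fun w => `|Y w|) by exact: measurableT_comp.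
have mY2 : measurable_fun setT (fun w => Y w ^+ 2) by exact: measurable_funX.
have mB : measurable B.
  rewrite (_ : B = [set w | (4 * L)^-1 <= `|Y w|] `&`
    [set w | Z w <= 4 * L ^+ 2 * k])//.
  rewrite -[X in measurable (X `&` _)]setTI -[X in measurable (_ `&` X)]setTI.
  by apply: measurableI; apply: measurable_fun_le.
have mB' : measurable_fun setT (\1_B : T -> R) by exact: measurable_indic.
have pw w : `|Y w| <= (4 * L)^-1 + ((4 * L)^-1 * Y w ^+ 2 +
    L * (\1_B w + (4 * L ^+ 2 * k)^-1 * Z w)).
  have K0 : 0 < 4 * L ^+ 2 * k by rewrite !mulr_gt0// exprn_gt0.
  have V0 : 0 < (4 * L)^-1 by rewrite invr_gt0; lra.
  have am : `|Y w| <= (4 * L)^-1 * Y w ^+ 2 + L.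
    rewrite -(real_normK (num_real (Y w))).
    have : 0 <= (4 * L)^-1 * (`|Y w| - 2 * L) ^+ 2.
      by rewrite mulr_ge0 ?sqr_ge0// ltW.
    have -> : (4 * L)^-1 * (`|Y w| - 2 * L) ^+ 2 =
        (4 * L)^-1 * `|Y w| ^+ 2 - `|Y w| + L by field; lra.
    lra.
  have tz : 0 <= (4 * L ^+ 2 * k)^-1 * Z w by rewrite mulr_ge0// invr_ge0 ltW.
  have ty : 0 <= (4 * L)^-1 * Y w ^+ 2 by rewrite mulr_ge0 ?sqr_ge0// ltW.
  rewrite indicE; case: (boolP (w \in B)) => [_|] /=; first by nra.
  rewrite notin_setE /B /= => /not_andP[/negP|/negP]; rewrite -ltNge => H.
    by rewrite add0r; nra.
  have : 1 <= (4 * L ^+ 2 * k)^-1 * Z w.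
    by rewrite mulrC ler_pdivlMr// mul1r ltW.
  nra.
have L4 : (0 <= (4 * L)^-1)%R by rewrite invr_ge0; lra.
have K4 : (0 <= (4 * L ^+ 2 * k)^-1)%R by rewrite invr_ge0 !mulr_ge0// ?ltW// exprn_gt0.
pose u := (4 * L ^+ 2 * k)^-1; pose v := (4 * L)^-1.
have mYc : measurable_fun setT (fun w => v%:E * (Y w ^+ 2)%:E)%E.
  by apply: measurable_funeM; exact/measurable_EFinP.
have mZc : measurable_fun setT (fun w => u%:E * (Z w)%:E)%E.
  by apply: measurable_funeM; exact/measurable_EFinP.
have mBZ : measurable_fun setT (fun w => (\1_B w)%:E + u%:E * (Z w)%:E)%E.
  by apply: emeasurable_funD => //; exact/measurable_EFinP.
have mLBZ := measurable_funeM L%:E mBZ.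
have mS := emeasurable_funD mYc mLBZ.
have : (\int[P]_w `|Y w|%:E <=
   v%:E + (v%:E * 1 + L%:E * (P B + u%:E * k%:E)))%E.
  have -> : (v%:E + (v%:E * 1 + L%:E * (P B + u%:E * k%:E)) =
    \int[P]_w (v%:E + (v%:E * (Y w ^+ 2)%:E +
      L%:E * ((\1_B w)%:E + u%:E * (Z w)%:E))))%E.
    rewrite ge0_integralD//=; last first.
    - by move=> w _; rewrite adde_ge0 ?mule_ge0 ?adde_ge0 ?mule_ge0 ?lee_fin ?sqr_ge0// ltW.
    rewrite integral_cst//= probability_setT mule1; congr (_ + _)%E.
    rewrite ge0_integralD//=; last 2 first.
    - by move=> w _; rewrite ?mule_ge0 ?lee_fin ?sqr_ge0// ltW.
    - by move=> w _; rewrite mule_ge0 ?adde_ge0 ?mule_ge0 ?lee_fin ?sqr_ge0// ltW.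
    rewrite ge0_integralZl_EFin//=; last 2 first.
    - by move=> w _; rewrite lee_fin sqr_ge0.
    - exact/measurable_EFinP.
    rewrite Y2; congr (_ + _)%E; first by rewrite mule1.
    rewrite ge0_integralZl_EFin//=; last 2 first.
    - by move=> w _; rewrite adde_ge0 ?mule_ge0 ?lee_fin ?sqr_ge0// ltW.
    - exact: ltW.
    congr (_ * _)%E.
    rewrite ge0_integralD//=; last 2 first.
    - exact/measurable_EFinP.
    - by move=> w _; rewrite mule_ge0 ?lee_fin.
    rewrite integral_indic// setIT ge0_integralZl_EFin//= ?Zk//.
      by move=> w _; rewrite lee_fin.
    exact/measurable_EFinP.
  apply: ge0_le_integral => //=.
  - exact/measurable_EFinP.
  - exact: emeasurable_funD.
  - by move=> w _; rewrite -!EFinM -!EFinD lee_fin.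
move=> H.
have {H} := le_trans YL (lee_wpmul2l _ H).
rewrite lee_fin => /(_ (ltW L0)).
have -> : P B = (fine (P B))%:E by rewrite fineK// fin_num_measure.
set p := fine _ => H.
have {}H : 1 <= L * (v + (v * 1 + L * (p + u * k))).
  by rewrite -lee_fin; exact: H.
have E : L * (v + (v * 1 + L * (p + u * k))) = 3 / 4 + L ^+ 2 * p.
  rewrite /u /v; field; lra.
rewrite lee_fin -[leLHS]mul1r ler_pdivrMr ?mulr_gt0// ?exprn_gt0//.
nra.
Qed.

(** [truncated_small_ball] with the squared norm of [X] as the control variable: by
isotropy the L2 norm of the marginal is 1, and summing the second moments of the
coordinates shows that the squared norm has mean [n]. *)
Lemma isotropic_spread d (T : measurableType d) (R : realType)
    (P : probability T R) (n : nat) (X : {RV P >-> n.-tuple R}) (L : R)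
    (t : 'cV[R]_n) :
  (0 < n)%N -> 0 < L -> isotropic X -> sphere R n t ->
  ('N[P]_2%:E[(fun w => (inner (vec (X w)) t)%:E)] <=
     L%:E * 'N[P]_1[(fun w => (inner (vec (X w)) t)%:E)])%E ->
  (((4 * L ^+ 2)^-1)%:E <=
     P (X @^-1` spread_set (4 * L)^-1 (4 * L ^+ 2 * n%:R) t))%E.
Proof.
move=> n0 L0 iso t1 NL.
have mi y : measurable_fun setT (fun w => inner (vec (X w)) y).
  by apply: measurableT_comp (measurable_inner_vec y) _.
have Y2 y : (\int[P]_w (inner (vec (X w)) y ^+ 2)%:E = (inner y y)%:E)%E.
  by have := iso y; rewrite unlock sqr_l2norm.
apply: (@truncated_small_ball _ _ _ _ (fun w => inner (vec (X w)) t)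
   (fun w => inner (vec (X w)) (vec (X w)))) => //.
- by apply: measurableT_comp (@measurable_sqnorm_vec R n) _.
- by move=> w; exact: inner_ge0.
- by rewrite ltr0n.
- by rewrite Y2; move/sphereE : t1 => ->.
- pose e j : 'cV[R]_n := delta_mx j 0.
  have ie y j : inner y (e j) = y j 0.
    rewrite /inner (bigD1 j)//= mxE !eqxx mulr1 big1 ?addr0// => k /negbTE kj.
    by rewrite mxE kj mulr0.
  under eq_integral.
    move=> w _; rewrite sqnormE; under eq_bigr do rewrite -ie.
    rewrite -sumEFin; over.
  rewrite ge0_integral_sum//=; last 2 first.
  + by move=> j; apply/measurable_EFinP; exact: measurable_funX.
  + by move=> j w _; rewrite lee_fin sqr_ge0.
  under eq_bigr do rewrite Y2 ie mxE !eqxx.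
  by rewrite sumEFin sumr_const card_ord.
- move: NL; rewrite Lnorm1; apply: le_trans.
  rewrite unlock (_ : (\int[P]_w _)%E = 1%E) ?poweR1r//.
  transitivity (inner t t)%:E; last by move/sphereE : t1 => ->.
  rewrite -Y2; apply: eq_integral => w _.
  by rewrite /= powR_mulrn// real_normK// num_real.
Qed.

Lemma spread_setZ (R : realType) (n : nat) (a k e : R) (y : 'cV[R]_n) :
  0 < e ->
  spread_set a k y = spread_set (e * a) k (e *: y).
Proof.
move=> e0; apply/seteqP; split => x [xa xk]; split => //; move: xa;
  by rewrite innerZr normrM (gtr0_norm e0) ler_pM2l.
Qed.

(** * Lower bound on the sphere *)

(** The rounding net is applied to the form built from the rows with
[inner (x i) (x i) <= k * n] only, which bounds its trace by [k * n]. On the net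
this form still sees the [m * N] rows whose marginal is at least [a], since these
rows are short as well. *)
Lemma truncated_gram_ge (R : realType) (n N r : nat) (x : 'I_N -> 'cV[R]_n)
    (s : seq 'cV[R]_n) (a k m : R) (t : 'cV[R]_n) :
  (0 < n)%N -> (0 < N)%N -> (0 < r)%N -> 0 <= a -> 0 <= k ->
  (forall q d t, quadratic q d -> sphere R n t -> exists2 y, y \in s &
     q y <= q t + (r%:R ^+ 2 * n%:R)^-1 * \sum_j `|d j|) ->
  (forall y, y \in s -> m * N%:R <=
     #|[set i | `[< a <= `|inner (x i) y| /\
                    inner (x i) (x i) <= k * n%:R >]]%SET|%:R) ->
  sphere R n t ->
  m * a ^+ 2 - k / r%:R ^+ 2 <= \sum_i N%:R^-1 * inner (x i) t ^+ 2.
Proof.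
move=> n0 N0 r0 a0 k0 net cnt t1.
pose c i : R := if inner (x i) (x i) <= k * n%:R then N%:R^-1 else 0.
have NR : 0 < N%:R :> R by rewrite ltr0n.
have NR' : 0 <= N%:R^-1 :> R by rewrite invr_ge0.
have c0 i : 0 <= c i by rewrite /c; case: ifP.
have [y ys qy] := net _ _ _ (quadratic_sum c x) t1.
apply: (@le_trans _ _ (\sum_i c i * inner (x i) t ^+ 2)); last first.
  apply: ler_sum => i _; rewrite ler_wpM2r ?sqr_ge0// /c; case: ifP => //.
rewrite lerBlDr; apply: (@le_trans _ _ (\sum_i c i * inner (x i) y ^+ 2)).
  pose S := [set i | `[< a <= `|inner (x i) y| /\
                        inner (x i) (x i) <= k * n%:R >]]%SET.
  apply: (@le_trans _ _ (\sum_(i in S) N%:R^-1 * a ^+ 2)).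
    have {}cnt := cnt _ ys.
    rewrite sumr_const -[leRHS]mulr_natl [leRHS]mulrA.
    by rewrite ler_wpM2r ?sqr_ge0// ler_pdivlMr.
  rewrite big_mkcond; apply: ler_sum => i _; case: ifP.
    rewrite inE => /asboolP[ay xk]; rewrite /c xk ler_wpM2l//.
    by rewrite -(real_normK (num_real (inner _ _))) lerXn2r// nnegrE.
  by move=> _; rewrite mulr_ge0 ?sqr_ge0.
apply: (le_trans qy); rewrite lerD2l.
have -> : k / r%:R ^+ 2 = (r%:R ^+ 2 * n%:R)^-1 * (k * n%:R).
  by field; rewrite !pnatr_eq0 -!lt0n n0 r0.
rewrite ler_wpM2l ?invr_ge0 ?mulr_ge0 ?exprn_ge0//.
rewrite (eq_bigr (fun j => \sum_i c i * x i j 0 ^+ 2)); last first.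
  by move=> j _; rewrite ger0_norm// sumr_ge0// => i _; rewrite mulr_ge0 ?sqr_ge0.
rewrite exchange_big /=.
apply: (@le_trans _ _ (\sum_(i < N) N%:R^-1 * (k * n%:R))).
  apply: ler_sum => i _; rewrite -big_distrr /= -sqnormE /c; case: ifP => H.
    by rewrite ler_wpM2l.
  by rewrite mul0r !mulr_ge0.
by rewrite sumr_const card_ord -[leLHS]mulr_natl [leLHS]mulrA divff ?mul1r// gt_eqF.
Qed.

Theorem theorem1p4 (R : realType) (L : R) :
  exists c1 c2 c3 : R, [/\ 0 < c1, 0 < c2, 0 < c3 &
    forall (n N : nat)
      (d0 : measure_display) (T0 : measurableType d0) (P0 : probability T0 R)
      (X : {RV P0 >-> n.-tuple R})
      (d : measure_display) (T : measurableType d) (P : probability T R)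
      (Xs : 'I_N -> {RV P >-> n.-tuple R}),
    (0 < n)%N ->
    isotropic X ->
    (forall t : 'cV[R]_n, sphere R n t ->
      ('N[P0]_2%:E[(fun w => (inner (vec (X w)) t)%:E)] <=
       L%:E * 'N[P0]_1[(fun w => (inner (vec (X w)) t)%:E)])%E) ->
    independent Xs ->
    (forall i, same_distribution (Xs i) X) ->
    c1 * n%:R <= N%:R ->
    ((1 - 2 * expR (- (c2 * N%:R)))%:E <=
     P [set w | (c3 <= lambda_min (Gamma (fun i => vec (Xs i w))))%R])%E].
Proof.
(* Raising L to at least 1 keeps the hypothesis and gives [q <= 1 / 4]. *)
have [L' [LL' L1]] : exists L', L <= L' /\ 1 <= L'.
  by exists (Num.max L 1); rewrite !le_max !lexx orbT.
have L0 : 0 < L' by lra.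
pose k := 4 * L' ^+ 2; pose q := k^-1.
have k4 : 4 <= k by rewrite /k; nra.
have q0 : 0 < q by rewrite invr_gt0; lra.
have qk : q * k = 1 by rewrite mulVf// gt_eqF; lra.
have q1 : q <= 1 / 4 by nra.
(* Rounding loses [k / r ^+ 2]; this choice of r makes it at most half of the
   gain [q ^+ 2 / 8 * (q / 16)] on the net. *)
have [r r16] : exists r : nat, 16 / q ^+ 2 <= r%:R.
  by exists (Num.truncn (16 / q ^+ 2)).+1; rewrite ltW// truncnS_gt.
have q20 : 0 < q ^+ 2 by rewrite exprn_gt0.
have rq : 16 <= r%:R * q ^+ 2 by rewrite -ler_pdivrMr.
have r2 : (2 <= r)%N by rewrite -(ler_nat R); nra.
(* The net has at most [2 ^ (A * n)] points. *)
pose A : R := (4 * r ^ 2 + 2)%N%:R.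
have A0 : 0 < A by rewrite ltr0n addn2.
(* This c1 bounds the size of the net by [expR (q / 8 * N)], half of the exponent
   [q / 4] of [few_successes]; c3 is what remains of the gain. *)
exists (8 * A / q), (q / 8), (Num.sqrt (q ^+ 3 / 256)).
have q3 : 0 < q ^+ 3 / 256 by rewrite divr_gt0// exprn_gt0.
split; rewrite ?divr_gt0 ?mulr_gt0 ?sqrtr_gt0//.
move=> n N d0 T0 P0 X d T P Xs n0 iso NL ind same cN.
have nR : 0 < n%:R :> R by rewrite ltr0n.
have N0 : (0 < N)%N.
  by rewrite -(ltr_nat R); apply: lt_le_trans cN; rewrite mulr_gt0 ?divr_gt0 ?mulr_gt0.
have [s [sz s1 net]] := rounding_net R n0 r2.
(* Points of the net have norm at least 1/2, which halves the level [1 / (4 L')]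
   valid for unit vectors. *)
pose a : R := (8 * L')^-1.
pose G y := spread_set a (k * n%:R) y : set (n.-tuple R).
have mG y : measurable (G y) by exact: measurable_spread_set.
have PG y i : 1 / 4 <= inner y y -> (q%:E <= P (Xs i @^-1` G y))%E.
  move=> y1; have -> : P (Xs i @^-1` G y) = P0 (X @^-1` G y) by exact: same.
  have y0 : 0 < inner y y by lra.
  pose e := Num.sqrt (inner y y).
  have e0 : 0 < e by rewrite sqrtr_gt0.
  have eE : e ^+ 2 = inner y y by rewrite sqr_sqrtr// ltW.
  have e1 : 1 / 2 <= e by nra.
  pose t := e^-1 *: y.
  have t1 : sphere R n t.
    by apply/sphereE; rewrite sqnormZ exprVn eE mulVf// gt_eqF.
  have yt : y = e *: t by rewrite scalerA mulfV ?scale1r// gt_eqF.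
  have NL' : ('N[P0]_2%:E[(fun w => (inner (vec (X w)) t)%:E)] <=
     L'%:E * 'N[P0]_1[(fun w => (inner (vec (X w)) t)%:E)])%E.
    by apply: le_trans (NL _ t1) _; rewrite lee_wpmul2r ?Lnorm_ge0.
  apply: le_trans (isotropic_spread n0 L0 iso t1 NL') _.
  apply: le_measure; rewrite ?inE.
  - by apply: measurable_funPTI; exact: measurable_spread_set.
  - exact: measurable_funPTI.
  move=> w; rewrite /G yt /= (spread_setZ _ _ _ e0) => -[xa xk]; split => //.
  apply: le_trans xa; rewrite /a.
  have -> : (4 * L')^-1 = 2 * (8 * L')^-1 by field; lra.
  by rewrite mulrA ler_peMl ?invr_ge0; lra.
pose few y (F : set T) := [/\ measurable F,
  (P F <= (expR (- (q / 4 * N%:R)))%:E)%E &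
  forall w, ~ F w ->
    q ^+ 2 / 8 * N%:R <= #|[set i | `[< G y (Xs i w) >]]%SET|%:R].
have [F FP] : {F & forall y, 1 / 4 <= inner y y -> few y (F y)}.
  apply: (@choice _ _ (fun y F => 1 / 4 <= inner y y -> few y F)) => y.
  have [y1|] := boolP (1 / 4 <= inner y y); last by exists set0.
  have [||B ?] := few_successes ind (mG y) q0; [lra|by move=> i; exact: PG|].
  by exists B.
have [||B [mB PB FB]] := @union_bound _ _ _ P _ s xpredT F
  (fun=> expR (- (q / 4 * N%:R))).
- by move=> y /s1 /FP[].
- by move=> y /s1 /FP[].
have c30 : 0 <= Num.sqrt (q ^+ 3 / 256) by rewrite sqrtr_ge0.
apply: (@le_trans _ _ (P (~` B))); last first.
  apply: le_measure; rewrite ?inE; first exact: measurableC.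
    exact: measurable_lambda_min_Gamma.
  move=> w nB /=; apply/lambda_min_geP => // t t1; rewrite sqnorm_Gamma.
  rewrite sqr_sqrtr; last exact: ltW.
  apply: le_trans; last first.
    apply: (truncated_gram_ge (a := a) (k := k) (m := q ^+ 2 / 8) n0 N0
      (ltnW r2) _ _ net) => //.
    - by rewrite invr_ge0; lra.
    - lra.
    - move=> y ys; have [_ _] := FP _ (s1 _ ys); apply => Fy.
      by apply: nB; exact: FB Fy.
  have -> : a ^+ 2 = q / 16 by rewrite /a /q /k; field; rewrite gt_eqF.
  have : k / r%:R ^+ 2 <= q ^+ 3 / 256.
    rewrite ler_pdivrMr ?exprn_gt0 ?ltr0n ?(ltnW r2)//.
    have -> : q ^+ 3 / 256 * r%:R ^+ 2 = q * k * (q ^+ 3 / 256 * r%:R ^+ 2).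
      by rewrite qk mul1r.
    have -> : q * k * (q ^+ 3 / 256 * r%:R ^+ 2) =
        k * ((r%:R * q ^+ 2) ^+ 2 / 256) by field.
    have : 16 ^+ 2 <= (r%:R * q ^+ 2) ^+ 2.
      by rewrite lerXn2r// nnegrE ?mulr_ge0// ltW.
    by move=> H; rewrite ler_peMr; lra.
  lra.
rewrite probability_setC//.
apply: (@le_trans _ _ (1 - (expR (- (q / 8 * N%:R)))%:E)%E).
  rewrite -EFinB lee_fin; have := expR_ge0 (- (q / 8 * N%:R)); lra.
apply: leeB => //; apply: (le_trans PB); rewrite lee_fin.
rewrite big_const_seq count_predT iter_addr_0 -[leLHS]mulr_natl.
have sE : (size s)%:R <= expR (A * n%:R) :> R.
  apply: le_trans (_ : (2 ^ ((4 * r ^ 2 + 2) * n))%N%:R <= _).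
    by rewrite ler_nat.
  rewrite natrX -natrM -[X in expR X]mulr1 expRM_natl lerXn2r// ?nnegrE ?expR_ge0//.
  by apply: le_trans (expR_ge1Dx 1); lra.
apply: (@le_trans _ _ (expR (A * n%:R) * expR (- (q / 4 * N%:R)))).
  by rewrite ler_wpM2r// expR_ge0.
rewrite -expRD ler_expR.
have : A * n%:R <= q / 8 * N%:R.
  have -> : A * n%:R = q / 8 * (8 * A / q * n%:R) by field; lra.
  by rewrite ler_wpM2l//; lra.
lra.
Qed.
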